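(* Let $h_1,h_2\in\mathcal{H}$ and let $c_i:\mathbb{R}^d\times\mathbb{R}^d\to[0,\infty)$, $c_i(x,y)=h_i(x-y)$, for $i\in\{1,2\}$. Suppose there is a non-empty family $\{(\mu^{(v)},\nu^{(v)})\}_{v\in\mathcal{V}}\subset\mathcal{P}(\mathbb{R}^d)\times\mathcal{P}(\mathbb{R}^d)$ such that for every $v\in\mathcal{V}$ it holds that $\mu^{(v)}\ll\lambda_d$ and there exist a plan $\pi^{(v)}\in\Pi(\mu^{(v)},\nu^{(v)})$ and a pair $(f^{(v)},g^{(v)})$ such that $\pi^{(v)}$ is an optimal transport plan and $(f^{(v)},g^{(v)})$ are optimal potentials for $\mu^{(v)}$ and $\nu^{(v)}$ with respect to $c_1$ and $c_2$ simultaneously. Then $(\nabla h_1^* )(y)=(\nabla h_2^* )(y)$ for every $$y\in\mathcal{X}:=\bigcup_{v\in\mathcal{V}}\{\nabla f^{(v)}(x): x\in\operatorname{int}(\operatorname{supp}\mu^{(v)})\}.$$ As a consequence, for any open and connected set $\mathcal{X}'\subseteq\mathbb{R}^d$ such that $\nabla h_1(\mathcal{X}')\subseteq\mathcal{X}$, it holds that $h_1=h_2+k$ on $\mathcal{X}'$ for some constant $k\in\mathbb{R}$. Moreover, if there exists $v\in\mathcal{V}$ such that $\mathcal{T}_{c_1}(\mu^{(v)},\nu^{(v)})=\mathcal{T}_{c_2}(\mu^{(v)},\nu^{(v)})$ together with $\{x-y: x\in\operatorname{supp}\mu^{(v)},\ y\in\operatorname{supp}\nu^{(v)}\}\subseteq\mathcal{X}'$,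 then even $k=0$.
   Context: $\mathcal{P}(\mathbb{R}^d)$ is the set of Borel probability measures on $\mathbb{R}^d$, $\lambda_d$ is Lebesgue measure, $\mu\ll\lambda_d$ means absolute continuity, $\operatorname{supp}\mu$ is the closed support, and $\operatorname{int}$ denotes interior. For a continuous cost $c:\mathbb{R}^d\times\mathbb{R}^d\to[0,\infty)$, $\mathcal{T}_c(\mu,\nu)=\min_{\pi\in\Pi(\mu,\nu)}\int c\,d\pi$, where $\Pi(\mu,\nu)$ is the set of probability measures on $\mathbb{R}^d\times\mathbb{R}^d$ with marginals $\mu,\nu$; a minimizer is called an optimal transport (OT) plan. Let $\Phi_c(\mu,\nu)=\{(f,g)\in L^1(\mu)\times L^1(\nu): f(x)+g(y)\le c(x,y)\ \text{for all } x,y\in\mathbb{R}^d\}$. Optimal potentials are the pairs $(f,g)\in\Phi_c(\mu,\nu)$ with $\int f\,d\mu+\int g\,d\nu=\mathcal{T}_c(\mu,\nu)$. $\mathcal{H}$ is the set of strictly convex and differentiable functions $h:\mathbb{R}^d\to[0,\infty)$ satisfying both of the following. (a) For every height $r>0$ and angle $\theta\in(0,\pi)$, for all points $x\in\mathbb{R}^d$ far enough from the origin there exists $z\in\mathbb{R}^d\setminus\{0\}$ such that on the cone $\{y\in\mathbb{R}^d:\|y-x\|\,\|z\|\cos(\theta/2)\le\langle z,y-x\rangle\le r\|z\|\}$ with vertex $x$, $h$ attains its maximum at $x$. (b) $h(x)/\|x\|\to\infty$ as $\|x\|\to\infty$. $h^*(y)=\sup_{x\in\mathbb{R}^d}\{\langle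 x,y\rangle-h(x)\}$ is the convex conjugate; for $h\in\mathcal{H}$ it is differentiable with $\nabla h^*=[\nabla h]^{-1}$. In sets of the form $\{\nabla f(x):x\in A\}$, $x$ ranges over those points of $A$ at which $f$ is differentiable. *)

(* Defs.v *)
From HB Require Import structures.
From mathcomp Require Import all_boot all_order all_algebra.
From mathcomp Require Import all_classical all_reals all_analysis.
From mathcomp Require Import measurable_realfun.
From mathcomp Require Import lra.

Set Implicit Arguments.
Unset Strict Implicit.
Unset Printing Implicit Defensive.

Import Order.TTheory GRing.Theory Num.Theory.
Import numFieldNormedType.Exports.

Local Open Scope classical_set_scope.
Local Open Scope ring_scope.

(* R^d is 'rV[R]_d. The library gives it a topology, but no sigma-algebra: we
   equip it with the Borel one. On the product of two such spaces the library
   uses the product sigma-algebra, which is again the Borel one since R^d is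
   second countable. *)
Section Borel.
Variables (R : realType) (d : nat).

Definition rV_borel : set (set 'rV[R]_d) := <<s open >>.

Lemma rV_borel0 : rV_borel set0.
Proof. exact: sigma_algebra0. Qed.

Lemma rV_borelC (A : set 'rV[R]_d) : rV_borel A -> rV_borel (~` A).
Proof. exact: sigma_algebraC. Qed.

Lemma rV_borel_bigcup (F : (set 'rV[R]_d)^nat) :
  (forall i, rV_borel (F i)) -> rV_borel (\bigcup_i F i).
Proof. exact: sigma_algebra_bigcup. Qed.

HB.instance Definition _ := @isMeasurable.Build default_measure_display
  'rV[R]_d rV_borel rV_borel0 rV_borelC rV_borel_bigcup.

Lemma rV_open_measurable (U : set 'rV[R]_d) : open U -> measurable U.
Proof. exact: sub_sigma_algebra. Qed.

End Borel.

Section Lebesgue.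
Variables (R : realType) (d : nat).

Definition row_cons (p : R * 'rV[R]_d) : 'rV[R]_d.+1 :=
  \row_i oapp (p.2 0) p.1 (unlift 0 i).

Definition row_uncons (v : 'rV[R]_d.+1) : R * 'rV[R]_d :=
  (v 0 0, \row_i v 0 (lift 0 i)).

Lemma row_consK : cancel row_cons row_uncons.
Proof.
move=> [x v]; congr pair; first by rewrite /= mxE unlift_none.
by apply/rowP => i; rewrite !mxE liftK.
Qed.

Lemma row_unconsK : cancel row_uncons row_cons.
Proof.
move=> v; apply/rowP => i; rewrite mxE /=.
by case: unliftP => [j|] -> //=; rewrite mxE.
Qed.

Lemma measurable_row_uncons : measurable_fun setT row_uncons.
Proof.
apply: measurable_fun_pair => /=.
  apply: (measurability _ (RGenOInfty.measurableE R)) => _ [_ [x ->] <-].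
  rewrite setTI; apply: rV_open_measurable; apply: open_comp; last exact: interval_open.
  by move=> v _; exact: coord_continuous.
apply: (measurability (@open 'rV[R]_d)) => // _ [U oU <-].
rewrite setTI; apply: rV_open_measurable; apply: open_comp => // v _ B.
move=> [P vP PB]; exists (fun i (j : 'I_d.+1) => oapp (P i) setT (unlift 0 j)).
  move=> i j; case: unliftP => [k ->|_] /=; last exact: filterT.
  by have := vP i k; rewrite mxE ord1.
move=> w Pw; apply: PB => i j.
by have := Pw i (lift 0 j); rewrite liftK mxE ord1.
Qed.

(* An open set is a countable union of boxes with rational centre and radius. *)
Lemma measurable_row_cons : measurable_fun setT row_cons.
Proof.
apply: (measurability (@open 'rV[R]_d.+1)) => // _ [U oU <-]; rewrite setTI.
pose B (q : 'rV[rat]_d.+1 * rat) : set 'rV[R]_d.+1 :=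
  ball (map_mx ratr q.1 : 'rV[R]_d.+1) (ratr q.2).
have -> : U = \bigcup_(q in [set q | B q `<=` U]) B q.
  apply/seteqP; split=> [v Uv|v [q]]; last exact.
  have /nbhs_ballP[e /= e0 veU] : nbhs v U by exact: open_nbhs_nbhs.
  have [r /andP[r0 re]] : exists r : rat, (0 : R) < ratr r < e / 2.
    by have [|r rP] := @rat_in_itvoo R 0 (e / 2); [rewrite divr_gt0|exists r].
  have /fin_all_exists[q qP] (i : 'I_d.+1) :
      exists q : rat, v 0 i - ratr r < (ratr q : R) < v 0 i + ratr r.
    have [|q qP] := @rat_in_itvoo R (v 0 i - ratr r) (v 0 i + ratr r).
      by rewrite ltrD2l gtrN.
    by exists q.
  have vB : B (\row_i q i, r) v.
    split=> // i j; rewrite ord1 !mxE /ball /= ltr_distlC.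
    have /andP[? ?] := qP j; apply/andP; split; lra.
  exists (\row_i q i, r) => //= w wB; apply: veU.
  apply: (le_ball _ (ball_triangle (ball_sym vB) wB)) => /=; lra.
rewrite [X in measurable X](_ : _ = \bigcup_(q in [set q | B q `<=` U])
  row_cons @^-1` B q); last exact: preimage_bigcup.
rewrite bigcup_mkcond.
apply: countable_bigcupT_measurable => // q; case: ifP => // _.
have -> : row_cons @^-1` B q =
    ball (ratr (q.1 0 0) : R) (ratr q.2) `*` ball (map_mx ratr (\row_i q.1 0 (lift 0 i)) : 'rV[R]_d) (ratr q.2).
  apply/seteqP; split=> [[x v] /= [r0 qv]|[x v] [/= qx [r0 qv]]].
    split=> /=.
      by have := qv 0 0; rewrite !mxE unlift_none.
    by split=> // i j; have := qv i (lift 0 j); rewrite !mxE liftK ord1.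
  split=> // i j; rewrite !mxE.
  case: unliftP => [k|] -> //=; rewrite ord1 //.
  by have := qv 0 k; rewrite !mxE.
apply: measurableX.
  by apply: open_measurable; exact: ball_open.
by apply: rV_open_measurable; exact: ball_open.
Qed.

Section consing.
Variable m : {sigma_finite_measure set 'rV[R]_d -> \bar R}.

Definition cons_lebesgue : set 'rV[R]_d.+1 -> \bar R :=
  pushforward (@lebesgue_measure R \x m)%E row_cons.

Let cons_lebesgue0 : cons_lebesgue set0 = 0%E.
Proof. by rewrite /cons_lebesgue /pushforward preimage_set0 measure0. Qed.

Let cons_lebesgue_ge0 A : (0 <= cons_lebesgue A)%E.
Proof. by rewrite /cons_lebesgue /pushforward measure_ge0. Qed.

Let cons_lebesgue_sigma_additive : semi_sigma_additive cons_lebesgue.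
Proof.
move=> F mF tF mUF; rewrite /cons_lebesgue /pushforward preimage_bigcup.
have mC A : measurable A -> measurable (row_cons @^-1` A).
  by move=> mA; rewrite -[X in measurable X]setTI; exact: measurable_row_cons.
apply: measure_semi_sigma_additive => [n||].
- exact: mC.
- apply/trivIsetP => j k _ _ jk; rewrite -preimage_setI.
  by move/trivIsetP : tF => ->//; rewrite preimage_set0.
- by rewrite -preimage_bigcup; exact: mC.
Qed.

HB.instance Definition _ := isMeasure.Build _ _ _ cons_lebesgue
  cons_lebesgue0 cons_lebesgue_ge0 cons_lebesgue_sigma_additive.

Let cons_lebesgue_sigma_finite : sigma_finite setT cons_lebesgue.
Proof.
have /sigma_finiteP[F [FT ndF Foo]] := sigma_finiteT (@lebesgue_measure R).
have /sigma_finiteP[G [GT ndG Goo]] := sigma_finiteT m.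
exists (fun n => row_uncons @^-1` (F n `*` G n)).
  apply/esym; rewrite -subTset => v _.
  have : setT (row_uncons v).1 by [].
  have : setT (row_uncons v).2 by [].
  rewrite FT GT => -[k _ Gk] [n _ Fn]; exists (maxn n k) => //; split.
    by move: Fn; exact/subsetPset/ndF/leq_maxl.
  by move: Gk; exact/subsetPset/ndG/leq_maxr.
move=> n; have [mF Fn] := Foo n; have [mG Gn] := Goo n; split.
  rewrite -[X in measurable X]setTI; apply: measurable_row_uncons => //.
  exact: measurableX.
rewrite /cons_lebesgue /pushforward -comp_preimage.
rewrite (_ : row_uncons \o row_cons = id) ?preimage_id; last first.
  by apply/funext => p; rewrite /= row_consK.
by rewrite product_measure1E// lte_mul_pinfty// ge0_fin_numE.
Qed.

HB.instance Definition _ := Measure_isSigmaFinite.Build _ _ _ cons_lebesgue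
  cons_lebesgue_sigma_finite.

End consing.

End Lebesgue.

(* Lebesgue measure on R^d: the d-fold product of the one on R. *)
Fixpoint lebesgue_rV (R : realType) (d : nat) :
    {sigma_finite_measure set 'rV[R]_d -> \bar R} :=
  if d is n.+1 then cons_lebesgue (lebesgue_rV R n) else \d_(0 : 'rV[R]_0).

Section Euclidean.
Variables (R : realType) (d : nat).
Implicit Types (x y z : 'rV[R]_d) (h : 'rV[R]_d -> R) (f : 'rV[R]_d -> \bar R).

Definition dot x y : R := \sum_i x 0 i * y 0 i.

(* The library norm on 'rV[R]_d is the sup norm, whence this definition. *)
Definition enorm x : R := Num.sqrt (dot x x).

Definition grad h x : 'rV[R]_d := \row_i 'd h x (delta_mx 0 i).

(* Differentiability of an extended-real function includes its finiteness in a
   neighborhood of the point. *)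
Definition ediff f x : Prop :=
  (\forall z \near x, f z \is a fin_num) /\ differentiable (fine \o f) x.

Definition egrad f x : 'rV[R]_d := grad (fine \o f) x.

Definition conjugate h y : \bar R :=
  ereal_sup (range (fun x => (dot x y - h x)%:E)).

Definition strictly_convex h : Prop :=
  forall x y (t : R), x != y -> 0 < t < 1 ->
    h (t *: x + (1 - t) *: y) < t * h x + (1 - t) * h y.

(* The cone with vertex x, axis z, opening angle theta and height r. *)
Definition cone (r theta : R) x z : set 'rV[R]_d :=
  [set y | enorm (y - x) * enorm z * cos (theta / 2) <= dot z (y - x)
           /\ dot z (y - x) <= r * enorm z].

Definition cone_condition h : Prop :=
  forall r theta : R, 0 < r -> 0 < theta < pi ->
    exists M : R, forall x, M < enorm x ->
      exists z, z != 0 /\ (forall y, cone r theta x z y -> h y <= h x).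

Definition superlinear h : Prop :=
  forall A : R, exists M : R, forall x, M < enorm x -> A < h x / enorm x.

Definition classH h : Prop :=
  [/\ forall x, 0 <= h x, strictly_convex h, forall x, differentiable h x,
      cone_condition h & superlinear h].

Definition translation_cost h x y : R := h (x - y).

End Euclidean.

Section Transport.
Variables (R : realType) (d : nat).
Local Notation E := 'rV[R]_d.
Implicit Types (c : E -> E -> R) (mu nu : probability E R)
  (p : probability (E * E)%type R) (f g : E -> \bar R).

Definition supp mu : set E := [set x | forall U, open U -> U x -> (0 < mu U)%E].

Definition coupling mu nu : set (probability (E * E)%type R) :=
  [set p | (forall A, measurable A -> p (A `*` setT) = mu A)
           /\ (forall B, measurable B -> p (setT `*` B) = nu B)].

Definition plan_cost c p : \bar R := (\int[p]_xy (c xy.1 xy.2)%:E)%E.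

Definition transport_cost c mu nu : \bar R :=
  ereal_inf (plan_cost c @` coupling mu nu).

Definition optimal_plan c mu nu p : Prop :=
  coupling mu nu p /\
  forall q, coupling mu nu q -> (plan_cost c p <= plan_cost c q)%E.

(* Potentials take values in [-oo, +oo[: the constraint is imposed everywhere,
   so it may force the value -oo off the support (e.g. for the quadratic cost,
   mu uniform on a ball and nu Gaussian). *)
Definition dual_feasible c mu nu f g : Prop :=
  [/\ mu.-integrable setT f, nu.-integrable setT g,
      forall x, (f x < +oo)%E, forall y, (g y < +oo)%E
    & forall x y, (f x + g y <= (c x y)%:E)%E].

Definition optimal_potentials c mu nu f g : Prop :=
  dual_feasible c mu nu f g /\
  (\int[mu]_x f x + \int[nu]_y g y = transport_cost c mu nu)%E.

Definition potential_gradients mu f : set E :=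
  [set egrad f x | x in [set x | (supp mu)° x /\ ediff f x]].

End Transport.

(* Main.v *)
(* Call (x, y) a contact point if f x + g y = c1 x y = c2 x y.  The slack of the
   dual constraint is nonnegative with zero integral against the plan, so almost
   every point of the plan is a contact point, for both costs at once.  If x0
   lies in the support of mu, there are contact points (x, y) with x as close to
   x0 as desired; when f is differentiable at x0, superlinearity of h1 keeps the
   y's bounded, and a cluster point y0 makes f - h_i(. - y0) locally maximal at
   x0 for i = 1, 2.  Hence grad f x0 = grad h_i (x0 - y0), and x0 - y0 is the
   gradient at grad f x0 of both conjugates.  On X' this gives
   grad h1 = grad h2, so h1 - h2 is constant there, and a contact point in
   supp mu x supp nu shows that the constant is 0. *)

Require Import Defs.
From HB Require Import structures.
From mathcomp Require Import all_boot all_order all_algebra.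
From mathcomp Require Import all_classical all_reals all_analysis.
From mathcomp Require Import measurable_realfun lra ring.

Set Implicit Arguments.
Unset Strict Implicit.
Unset Printing Implicit Defensive.

Import Order.TTheory GRing.Theory Num.Theory.
Import numFieldNormedType.Exports.

Local Open Scope classical_set_scope.
Local Open Scope ring_scope.

(** * The dot product and its comparison with the sup norm *)

Section DotProduct.
Variables (R : realType) (d : nat).
Implicit Types (x y v : 'rV[R]_d) (a : R).

Lemma dot0r x : dot x 0 = 0.
Proof. by rewrite /dot big1 // => i _; rewrite mxE mulr0. Qed.

Lemma dotDr x y v : dot x (y + v) = dot x y + dot x v.
Proof. by rewrite -big_split; apply: eq_bigr => i _; rewrite mxE mulrDr. Qed.

Lemma dotZr a x y : dot x (a *: y) = a * dot x y.
Proof. by rewrite /dot mulr_sumr; apply: eq_bigr => i _; rewrite mxE mulrCA. Qed.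

Lemma dotC x y : dot x y = dot y x.
Proof. by apply: eq_bigr => i _; rewrite mulrC. Qed.

Lemma dotBl x y v : dot (x - y) v = dot x v - dot y v.
Proof. by rewrite dotC dotDr -scaleN1r dotZr mulN1r !(dotC v). Qed.

Lemma dot_delta x i : dot x (delta_mx 0 i) = x 0 i.
Proof.
rewrite /dot (bigD1 i) //= mxE !eqxx mulr1 big1 ?addr0 // => j ji.
by rewrite mxE (negbTE ji) andbF mulr0.
Qed.

Lemma coord_le_norm x i : `|x 0 i| <= `|x|.
Proof.
rewrite [leRHS]/Num.norm /= mx_normrE; apply/bigmax_geP; right => /=.
by exists (0, i).
Qed.

(** Each of the [d] terms is at most the product of the sup norms, whence the factor [d] where the
    Euclidean norm would give 1. *)
Lemma dot_le_norm x y : `|dot x y| <= d%:R * `|x| * `|y|.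
Proof.
rewrite (le_trans (ler_norm_sum _ _ _)) //.
rewrite (@le_trans _ _ (\sum_(i < d) `|x| * `|y|)) //.
  by apply: ler_sum => i _; rewrite normrM ler_pM // coord_le_norm.
by rewrite sumr_const card_ord -mulrA mulr_natl.
Qed.

(** Links superlinearity, stated with the Euclidean norm, to the topology, given by the sup norm. *)
Lemma norm_le_enorm x : `|x| <= enorm x.
Proof.
have xge0 : 0 <= dot x x by apply: sumr_ge0 => i _; rewrite -expr2 sqr_ge0.
rewrite {1}/Num.norm /= mx_normrE; apply/bigmax_leP; split => [|[i j] _].
  exact: sqrtr_ge0.
rewrite ord1 /= -sqrtr_sqr ler_sqrt // /dot (bigD1 j) //= expr2 lerDl.
by apply: sumr_ge0 => k _; rewrite -expr2 sqr_ge0.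
Qed.

(** The linear structure lets [dot p] be identified as the differential of the conjugate. *)
HB.instance Definition _ (x : 'rV[R]_d) := GRing.isLinear.Build R 'rV[R]_d R _ (dot x)
  (fun a u v => etrans (dotDr x (a *: u) v) (congr1 (+%R^~ _) (dotZr a x u))).

Lemma dot_continuous x : continuous (dot x).
Proof.
apply: bounded_linear_continuous; apply/linear_boundedP.
near=> r => y; apply: le_trans (dot_le_norm x y) _.
by apply: ler_wpM2r => //; near: r; exact: nbhs_pinfty_ge.
Unshelve. all: by end_near. Qed.

End DotProduct.

(** * Differentials, convex functions and their conjugates, functions with zero differential *)

Section Gradient.
Variables (R : realType) (d : nat).
Implicit Types (x p q v : 'rV[R]_d) (h : 'rV[R]_d -> R).

Lemma diffE_dot h x v : differentiable h x -> 'd h x v = dot (grad h x) v.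
Proof.
move=> dh; rewrite {1}[v]row_sum_delta linear_sum /=.
by apply: eq_bigr => i _; rewrite mxE linearZ /= mulrC.
Qed.

(** The differential is the limit of the difference quotients from the right, so a bound on these
    passes to the limit. It serves both local maxima and convexity. *)
Lemma diff_le h x v (K : R) : differentiable h x ->
  (\forall t \near 0^'+, h (t *: v + x) - h x <= t * K) -> 'd h x v <= K.
Proof.
move=> dh hK; rewrite -deriveE //.
have dhv := cvg_dnbhs_at_right (@diff_derivable _ _ _ h x v dh).
apply: (cvgr_to_le dhv); near=> t.
have t0 : 0 < t by [].
by rewrite [_ *: _]mulrC ler_pdivrMr // mulrC /=; near: t.
Unshelve. all: by end_near. Qed.

Lemma diff_local_max h x v : differentiable h x ->
  (\forall y \near x, h y <= h x) -> 'd h x v = 0.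
Proof.
move=> dh hx.
have le0 w : 'd h x w <= 0.
  have wx : (t *: w + x) @[t --> 0^'+] --> x.
    rewrite -[X in _ --> X]add0r -[X in X + _](scale0r w).
    by apply: cvgD; [apply: cvgZr_tmp|exact: cvg_cst]; exact: (cvg_at_right_filter cvg_id).
  by apply: diff_le => //; near=> t; rewrite mulr0 subr_le0; near: t; exact: (wx _ hx).
(* The bound [le0] at [v] and at [- v]. *)
by apply/eqP; rewrite eq_le le0 -oppr_le0 -linearN le0.
Unshelve. all: by end_near. Qed.

(** Convexity bounds each difference quotient with [0 < t < 1] by [h y - h x]. *)
Lemma convex_diff_le h x y : strictly_convex h -> differentiable h x ->
  'd h x (y - x) <= h y - h x.
Proof.
move=> hc dh; apply: diff_le => //; near=> t.
have t0 : 0 < t by [].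
have t1 : t < 1 by near: t; exact: nbhs_right_lt.
have [->|yx] := eqVneq y x; first by rewrite subrr scaler0 add0r subrr mulr0.
have := hc _ _ t yx; rewrite t0 t1 => /(_ erefl) /ltW.
rewrite (_ : t *: (y - x) + x = t *: y + (1 - t) *: x); first lra.
by apply/rowP => i; rewrite !mxE; ring.
Unshelve. all: by end_near. Qed.

(** The tangent inequality at the midpoint [m], combined with strict convexity at [m], makes the
    inequality at [y] strict. *)
Lemma strictly_convex_diff_lt h x y : strictly_convex h ->
  differentiable h x -> x != y -> 'd h x (y - x) < h y - h x.
Proof.
move=> hc dh xy; pose m := 2^-1 *: y + (1 - 2^-1) *: x.
have := @convex_diff_le h x m hc dh.
have -> : m - x = 2^-1 *: (y - x).
  by apply/rowP => i; rewrite !mxE; ring.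
rewrite linearZ /= -[_ *: 'd _ _ _]/(2^-1 * 'd h x (y - x)) => dm.
have : h m < 2^-1 * h y + (1 - 2^-1) * h x.
  by apply: hc; [rewrite eq_sym|apply/andP; split; lra].
lra.
Qed.

Lemma convex_scale_le h x v (s : R) : strictly_convex h -> 0 < s <= 1 ->
  h (x + s *: v) - h x <= s * (h (x + v) - h x).
Proof.
move=> hc /andP[s0]; rewrite le_eqVlt => /predU1P[->|s1].
  by rewrite scale1r mul1r.
have [->|v0] := eqVneq v 0; first by rewrite scaler0 !addr0 subrr mulr0.
have := hc (x + v) x s; rewrite s0 s1 addrC -subr_eq0 addrK => /(_ v0 erefl).
rewrite addrC (_ : _ + _ = x + s *: v); first lra.
by apply/rowP => i; rewrite !mxE; ring.
Qed.

(* Let phi q = h q - h p - <q - p, grad h p>, which is positive off p.  If phi >= m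
   on the sphere of radius rho around p, then phi q >= m |q - p| / rho outside it
   by convexity, which beats the perturbation <q - p, e> for small e; inside the
   sphere that perturbation is O(rho |e|). *)
Lemma conjugate_max_le h p : strictly_convex h ->
    (forall x, differentiable h x) -> forall eps : R, 0 < eps ->
  exists2 eta : R, 0 < eta & forall e q, `|e| <= eta ->
    dot q (grad h p + e) - h q <=
    dot p (grad h p) - h p + dot p e + eps * `|e|.
Proof.
move=> hc dh eps eps0.
pose phi q := h q - h p - dot (q - p) (grad h p).
have phiE q : phi q = h q - h p - 'd h p (q - p) by rewrite diffE_dot // dotC.
(* In dimension 0 there is a single point and no sphere to minimise over. *)
have [d0|d0] := posnP d.
  exists 1 => // e q _; have -> : q = p by apply/rowP => i; have := ltn_ord i; rewrite [X in (_ < X)%N]d0.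
  by rewrite dotDr; have := mulr_ge0 (ltW eps0) (normr_ge0 e); lra.
have d1 : (0 : R) < d%:R by rewrite ltr0n.
(* This radius cancels the factor [d] of [dot_le_norm]: inside the sphere the perturbation is at
   most [eps * |e|]. *)
pose rho := eps / d%:R.
have rho0 : 0 < rho by rewrite divr_gt0.
pose S := [set q : 'rV[R]_d | `|q - p| = rho].
have normB_continuous : continuous (fun q : 'rV[R]_d => `|q - p|).
  move=> q; apply: (@continuous_comp _ _ _ (fun q => q - p)).
    exact: cvgB cvg_id (cvg_cst _).
  exact: (@norm_continuous _ _ (q - p)).
have cS : compact S.
  apply: bounded_closed_compact.
    exists (`|p| + rho); split=> [|M rM q /= qS]; first exact: num_real.
    by rewrite -(subrK p q) (le_trans (ler_normD _ _)) // qS addrC ltW.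
  apply: (@preimage_closed _ _ (fun q : 'rV[R]_d => `|q - p|) [set rho]).
    by move=> q _; exact: normB_continuous.
  exact: closed_eq.
have S0 : S !=set0.
  pose w : 'rV[R]_d := const_mx 1.
  have w0 : 0 < `|w|.
    rewrite normr_gt0; apply/eqP => /rowP/(_ (Ordinal d0))/eqP.
    by rewrite !mxE oner_eq0.
  exists (p + (rho / `|w|) *: w); rewrite /S /= addrC addKr normrZ.
  by rewrite gtr0_norm ?divr_gt0 // divfK // gt_eqF.
have phi_continuous : continuous phi.
  have dot_cont : continuous (fun q => dot (q - p) (grad h p)).
    rewrite (_ : (fun _ => _) = fun q => dot (grad h p) (q - p)); last first.
      by apply/funext => u; rewrite dotC.
    move=> q; apply: (@continuous_comp _ _ _ (fun q => q - p)).
      exact: cvgB cvg_id (cvg_cst _).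
    exact: (@dot_continuous _ _ (grad h p) (q - p)).
  move=> q; have hq := differentiable_continuous (dh q).
  exact: cvgB (cvgB hq (cvg_cst _)) (dot_cont q).
have [c cS' cmin] := EVT_min_rV S0 cS (continuous_subspaceT phi_continuous).
have phi_gt0 : 0 < phi c.
  rewrite phiE subr_gt0; apply: strictly_convex_diff_lt => //.
  move: cS'; rewrite inE /S /= => cp; rewrite -subr_eq0 -normr_gt0 distrC.
  by rewrite cp.
(* With this bound [d * |e| <= phi c / rho], the slope that convexity forces on [phi] outside the
   sphere. *)
exists (phi c / (rho * d%:R)) => [|e q]; first by rewrite divr_gt0 // mulr_gt0.
rewrite ler_pdivlMr ?(mulr_gt0 rho0) // => he.
suff : dot (q - p) e <= phi q + eps * `|e|.
  by rewrite /phi !dotBl dotDr; lra.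
have dqe : dot (q - p) e <= d%:R * `|q - p| * `|e|.
  exact: le_trans (ler_norm _) (dot_le_norm _ _).
have phi_ge0 : 0 <= phi q by rewrite phiE subr_ge0 convex_diff_le.
have [qp|qp] := leP `|q - p| rho.
  rewrite (le_trans dqe) // (@le_trans _ _ (eps * `|e|)) ?lerDr //.
  by rewrite ler_wpM2r // -ler_pdivlMl // mulrC.
have qp0 : 0 < `|q - p| := lt_trans rho0 qp.
have /cmin : p + (rho / `|q - p|) *: (q - p) \in S.
  rewrite inE /S /= addrC addKr normrZ gtr0_norm ?divr_gt0 //.
  by rewrite divfK // gt_eqF.
set s := rho / `|q - p|.
have s0 : 0 < s by rewrite divr_gt0.
have s1 : s <= 1 by rewrite ler_pdivrMr // mul1r ltW.
have := @convex_scale_le h p (q - p) s hc; rewrite s0 s1 => /(_ erefl).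
rewrite [p + (q - p)]addrC subrK => hs.
rewrite [leRHS]/phi [p + _ - p]addrC addKr (dotC (s *: _)) dotZr.
rewrite -(dotC (q - p)) => phis.
have {}phis : phi c * `|q - p| <= rho * phi q.
  have -> : rho = s * `|q - p| by rewrite divfK // gt_eqF.
  rewrite mulrAC ler_wpM2r // (le_trans phis) // [in leRHS]/phi.
  by rewrite mulrBr lerD2r.
apply: (le_trans dqe); apply: (@le_trans _ _ (phi q)).
  rewrite -(ler_pM2l rho0) (le_trans _ phis) //.
  have -> : rho * (d%:R * `|q - p| * `|e|) = `|e| * (rho * d%:R) * `|q - p|.
    by ring.
  exact: ler_wpM2r.
by rewrite lerDl mulr_ge0 // ltW.
Qed.

(** A first-order expansion of the conjugate at [grad h p]: the choice [q = p] in the supremum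
    bounds it from below, [conjugate_max_le] from above. The two bounds also give finiteness. *)
Lemma conjugate_max h p : strictly_convex h ->
    (forall x, differentiable h x) -> forall eps : R, 0 < eps ->
  \forall e \near (0 : 'rV[R]_d),
    conjugate h (grad h p + e) \is a fin_num /\
    `|fine (conjugate h (grad h p + e)) - (dot p (grad h p) - h p) - dot p e| <=
    eps * `|e|.
Proof.
move=> hc dh eps eps0.
have [eta eta0 le_eta] := @conjugate_max_le h p hc dh eps eps0.
near=> e.
have {}le_eta q := le_eta e q (_ : `|e| <= eta).
have ge : ((dot p (grad h p) - h p + dot p e)%:E <= conjugate h (grad h p + e))%E.
  apply: ereal_sup_ubound; exists p => //; congr EFin.
  by rewrite dotDr; ring.
have le : (conjugate h (grad h p + e) <=
    (dot p (grad h p) - h p + dot p e + eps * `|e|)%:E)%E.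
  apply: ge_ereal_sup => _ [q _ <-]; rewrite lee_fin; apply: le_eta.
  by near: e; exact: (@nbhs0_le R 'rV[R]_d _ eta0).
have fin : conjugate h (grad h p + e) \is a fin_num.
  by rewrite fin_numElt (lt_le_trans _ ge) ?ltNyr // (le_lt_trans le) ?ltry.
split=> //; move: ge le; rewrite -[conjugate _ _]fineK // !lee_fin /= => ge le.
rewrite ger0_norm; lra.
Unshelve. all: by end_near. Qed.

(** By uniqueness of the differential, the expansion of [conjugate_max] identifies it as [dot p]. *)
Lemma egrad_conjugate h p : strictly_convex h ->
  (forall x, differentiable h x) -> egrad (conjugate h) (grad h p) = p.
Proof.
move=> hc dh; set F := fine \o conjugate h.
(* The expansion at [e = 0] is the equality case of the Fenchel-Young inequality. *)
have F_grad : F (grad h p) = dot p (grad h p) - h p.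
  have := nbhs_singleton (@conjugate_max h p hc dh 1 ltr01).
  by rewrite addr0 normr0 mulr0 dot0r subr0 normr_le0 subr_eq0 => -[_ /eqP].
have dF : 'd F (grad h p) = dot p :> ('rV[R]_d -> R).
  apply: diff_unique; first exact: dot_continuous.
  apply/eqaddoP => eps eps0; near=> e.
  have [_] : conjugate h (grad h p + e) \is a fin_num /\
    `|fine (conjugate h (grad h p + e)) - (dot p (grad h p) - h p) - dot p e| <=
    eps * `|e|.
    by near: e; exact: conjugate_max.
  rewrite -F_grad => le_eps.
  rewrite -[X in `|X|]/(F (e + grad h p) - (F (grad h p) + dot p e)).
  by rewrite opprD addrA [e + _]addrC.
by apply/rowP => i; rewrite mxE dF dot_delta.
Unshelve. all: by end_near. Qed.

Lemma grad_inj h : strictly_convex h ->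
  (forall x, differentiable h x) -> injective (grad h).
Proof.
move=> hc dh x y gxy.
by rewrite -(egrad_conjugate x hc dh) gxy egrad_conjugate.
Qed.

(** First-order condition for [F - h \o s] at [x]; the translation [s] has the identity as
    differential. *)
Lemma grad_eq_local_max h (F : 'rV[R]_d -> R) x y :
  differentiable h (x - y) -> differentiable F x ->
  (\forall z \near x, F z - h (z - y) <= F x - h (x - y)) ->
  grad F x = grad h (x - y).
Proof.
move=> dh dF Fmax.
pose s : 'rV[R]_d -> 'rV[R]_d := id - cst y.
have ds : is_diff x s (id - 0) by exact: is_diffB.
have dsv v : 'd s x v = v by rewrite diff_val; exact: subr0.
have dhs : differentiable (h \o s) x by exact: differentiable_comp.
have dG := differentiableB dF dhs.
apply/rowP => i; rewrite [LHS]mxE [RHS]mxE.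
have Gmax := @diff_local_max _ x ('e_i) dG Fmax.
have dsx : differentiable s x by [].
have diffG : 'd (F - (h \o s)) x 'e_i = 'd F x 'e_i - 'd (h \o s) x 'e_i.
  exact: (congr1 (fun f => f 'e_i) (diffB dF dhs)).
have diffhs : 'd (h \o s) x 'e_i = 'd h (x - y) 'e_i.
  apply: (etrans (congr1 (fun f => f 'e_i) (diff_comp dsx dh))).
  exact: (congr1 ('d h (x - y)) (dsv 'e_i)).
apply: subr0_eq; apply: (etrans _ (etrans (esym diffG) Gmax)).
exact: (congr1 (fun u => 'd F x 'e_i - u) (esym diffhs)).
Qed.

(** A ball around [a] inside [X] contains the segment from [a] to each of its points; the mean value
    theorem applies along it. *)
Lemma diff0_locally_cst (F : 'rV[R]_d -> R) (X : set 'rV[R]_d) a :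
  open X -> (forall x, X x -> differentiable F x) ->
  (forall x v, X x -> 'd F x v = 0) -> X a ->
  \forall z \near a, X z /\ F z = F a.
Proof.
move=> oX dF F0 Xa.
have /nbhs_ballP[r /= r0 ra] : nbhs a X by exact: open_nbhs_nbhs.
apply/nbhs_ballP; exists r => //= z az; split; first exact: ra.
pose l (t : R) : 'rV[R]_d := t *: (z - a) + a.
have Xl (t : R) : t \in `[0, 1] -> X (l t).
  rewrite in_itv /= => /andP[t0 t1]; apply: ra.
  move: az; rewrite -!ball_normE /= => az.
  rewrite /l opprD addrCA subrr addr0 normrN normrZ ger0_norm //.
  by rewrite (le_lt_trans _ az) // distrC ler_piMl.
have dl t : differentiable l t by exact: differentiableD.
have dFl (t : R) : t \in `[0, 1] -> is_derive t 1 (F \o l) 0.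
  move=> /Xl Xt; have dFt := dF _ Xt.
  have dc : differentiable (F \o l) t by exact: differentiable_comp.
  apply: DeriveDef; first exact: diff_derivable.
  by rewrite deriveE // diff_comp //= F0.
have dFl_oo (t : R) : t \in `]0, 1[ -> is_derive t 1 (F \o l) 0.
  by move=> t01; apply: dFl; exact: subset_itv_oo_cc t01.
have cFl : {within `[0, 1], continuous (F \o l)}.
  by apply: derivable_within_continuous => t /dFl.
have [c _ Fl01] := MVT_segment ler01 dFl_oo cFl.
have l0 : l 0 = a by rewrite /l scale0r add0r.
have l1 : l 1 = z by rewrite /l scale1r subrK.
by apply: subr0_eq; rewrite -l0 -l1; apply: etrans Fl01 _; exact: mul0r.
Qed.

(** By local constancy, the level set of [F] through [x] is both open and closed in [X]. *)
Lemma diff0_connected_cst (F : 'rV[R]_d -> R) (X : set 'rV[R]_d) :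
  open X -> connected X -> (forall x, X x -> differentiable F x) ->
  (forall x v, X x -> 'd F x v = 0) ->
  forall x y, X x -> X y -> F x = F y.
Proof.
move=> oX cX dF F0 x y Xx Xy.
have loc a : X a -> \forall z \near a, X z /\ F z = F a.
  exact: diff0_locally_cst.
pose B := X `&` [set z | F z = F x].
suff BX : B = X by have : B y; [rewrite BX|case].
apply: cX; first by exists x.
- exists B; last by rewrite /B setIA setIid.
  rewrite openE => z [Xz Fz]; apply: filterS (loc z Xz) => w [Xw Fw].
  by split=> //=; rewrite Fw.
- exists (closure B); first exact: closed_closure.
  apply/seteqP; split => [z Bz|z [Xz Bz]].
    by split; [case: Bz|exact: subset_closure].
  have [w [[_ Fw] [_ Fwz]]] := Bz _ (loc z Xz).
  by split=> //=; rewrite -Fwz.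
Qed.

Lemma eq_grad_cst h1 h2 (X : set 'rV[R]_d) :
  (forall x, differentiable h1 x) -> (forall x, differentiable h2 x) ->
  open X -> connected X -> (forall x, X x -> grad h1 x = grad h2 x) ->
  forall x y, X x -> X y -> h1 x - h2 x = h1 y - h2 y.
Proof.
move=> dh1 dh2 oX cX gX; apply: (@diff0_connected_cst (h1 - h2)) => // x.
  by move=> _; exact: differentiableB.
move=> v Xx; rewrite diffB // -[LHS]/('d h1 x v - 'd h2 x v).
by rewrite !diffE_dot // gX // subrr.
Qed.

End Gradient.

(** * Rational balls, measurability of the cost, and the support *)

Section Borel.
Variables (R : realType) (d : nat).
Local Notation E := 'rV[R]_d.

Lemma row_ball_basis (U : set E) v : open U -> U v ->
  exists q : 'rV[rat]_d * rat,
    ball (map_mx ratr q.1 : E) (ratr q.2) v /\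
    ball (map_mx ratr q.1 : E) (ratr q.2) `<=` U.
Proof.
move=> oU Uv.
have /nbhs_ballP[e /= e0 veU] : nbhs v U by exact: open_nbhs_nbhs.
(* A ball of radius below [e / 2] that contains [v] lies in the ball of radius [e] around [v]. *)
have [r /andP[r0 re]] : exists r : rat, (0 : R) < ratr r < e / 2.
  by have [|r rP] := @rat_in_itvoo R 0 (e / 2); [rewrite divr_gt0|exists r].
have /fin_all_exists[q qP] (i : 'I_d) :
    exists q : rat, v 0 i - ratr r < (ratr q : R) < v 0 i + ratr r.
  have [|q qP] := @rat_in_itvoo R (v 0 i - ratr r) (v 0 i + ratr r).
    by rewrite ltrD2l gtrN.
  by exists q.
have vB : ball (map_mx ratr (\row_i q i) : E) (ratr r) v.
  split=> // i j; rewrite ord1 !mxE /ball /= ltr_distlC.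
  by have /andP[? ?] := qP j; apply/andP; split; lra.
exists (\row_i q i, r); split=> // w wB; apply: veU.
by apply: (le_ball _ (ball_triangle (ball_sym vB) wB)) => /=; lra.
Qed.

(** A countable base of the topology, indexed by integers; an index that codes no ball gives the
    empty set. *)
Definition row_ball (n : nat) : set E :=
  if unpickle n is Some q then ball (map_mx ratr (q : 'rV[rat]_d * rat).1 : E) (ratr q.2)
  else set0.

Lemma row_ballP (U : set E) v : open U -> U v ->
  exists n, row_ball n v /\ row_ball n `<=` U.
Proof.
by move=> oU /(row_ball_basis oU)[q qP]; exists (pickle q); rewrite /row_ball pickleK.
Qed.

Lemma open_row_ball n : open (row_ball n).
Proof. by rewrite /row_ball; case: unpickle => [q|]; [exact: ball_open|exact: open0]. Qed.

Lemma open_bigcup_row_ball (U : set E) : open U ->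
  U = \bigcup_(n in [set n | row_ball n `<=` U]) row_ball n.
Proof.
move=> oU; apply/seteqP; split=> [v Uv|v [n /= nU]]; last exact: nU.
by have [n [? ?]] := row_ballP oU Uv; exists n.
Qed.

Lemma measurable_fun_row d' (T : measurableType d') (F : T -> E) :
  (forall i, measurable_fun setT (fun t => F t 0 i)) -> measurable_fun setT F.
Proof.
move=> mF; apply: (measurability (@open E)) => // _ [U oU <-]; rewrite setTI.
rewrite (open_bigcup_row_ball oU) preimage_bigcup.
apply: bigcup_measurable => n _; rewrite /row_ball.
case: unpickle => [[q r]|]; last by rewrite preimage_set0.
(* A sup-norm ball is a product of intervals. Positivity of the radius is kept apart, since for
   [d = 0] no coordinate enforces it. *)
have -> : F @^-1` ball (map_mx ratr q : E) (ratr r) = [set _ : T | 0 < (ratr r : R)] `&`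
    \bigcap_(i in [set: 'I_d]) ((fun t => F t 0 i) @^-1` ball (ratr (q 0 i) : R) (ratr r)).
  apply/seteqP; split=> t [r0 qt]; split=> // i.
    by move=> _; have := qt 0 i; rewrite mxE.
  by move=> j; rewrite ord1 mxE; exact: qt.
apply: measurableI.
  by case: (ltP 0) => _; [rewrite [X in measurable X](_ : _ = setT)//|
                          rewrite [X in measurable X](_ : _ = set0)//];
    apply/seteqP; split.
apply: fin_bigcap_measurable => // i _.
by rewrite -[X in measurable X]setTI; apply: mF => //; exact: measurable_ball.
Qed.

Lemma continuous_row_measurable (h : E -> R) :
  continuous h -> measurable_fun setT h.
Proof.
move=> ch; apply: (measurability _ (RGenOInfty.measurableE R)) => _ [_ [x ->] <-].
rewrite setTI; apply: rV_open_measurable; apply: open_comp => [v _|].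
  exact: ch.
exact: interval_open.
Qed.

(** The product carries the product sigma-algebra, so the measurability of [x - y] is checked
    coordinate by coordinate. *)
Lemma measurable_translation_cost (h : E -> R) : continuous h ->
  measurable_fun setT (fun xy : E * E => translation_cost h xy.1 xy.2).
Proof.
move=> ch; apply: (measurableT_comp (continuous_row_measurable ch)).
apply: measurable_fun_row => i.
have mi : measurable_fun setT (fun v : E => v 0 i).
  by apply: continuous_row_measurable; exact: coord_continuous.
have -> : (fun xy : E * E => (xy.1 - xy.2) 0 i) =
    ((fun v : E => v 0 i) \o fst) \- ((fun v : E => v 0 i) \o snd).
  by apply/funext => xy; rewrite /= !mxE.
by apply: measurable_funB; apply: measurableT_comp.
Qed.

(** A point off the support lies in a null ball of the base, and there are countably many of
    these. *)
Lemma supp_ae (mu : probability E R) : {ae mu, forall x, supp mu x}.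
Proof.
pose N n := if mu (row_ball n) == 0%E then row_ball n else set0.
apply: (@negligibleS _ _ _ _ (\bigcup_n N n)); last first.
  apply: negligible_bigcup => n; rewrite /N; case: eqP => [n0|_].
    by exists (row_ball n); split=> //; apply: rV_open_measurable; exact: open_row_ball.
  exact: negligible_set0.
move=> x /= /existsNP[U /not_implyP[oU /not_implyP[Ux /negP]]].
rewrite -leNgt => U0; have [n [nx nU]] := row_ballP oU Ux.
exists n => //; rewrite /N ifT // eq_le measure_ge0 andbT (le_trans _ U0) //.
apply: le_measure => //; rewrite inE; apply: rV_open_measurable => //.
exact: open_row_ball.
Qed.

End Borel.

(** * Transfer of integrals and null sets along a marginal *)

Section Marginal.
Context d1 d2 (X : measurableType d1) (Y : measurableType d2) (R : realType).
Variables (phi : X -> Y) (p : {measure set X -> \bar R}) (mu : {measure set Y -> \bar R}).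
Hypotheses (mphi : measurable_fun setT phi)
  (pmu : forall A, measurable A -> p (phi @^-1` A) = mu A).

Lemma integrable_marginal (f : Y -> \bar R) :
  mu.-integrable setT f -> p.-integrable setT (f \o phi).
Proof.
move=> /integrableP[mf foo]; apply/integrableP; split; first exact: measurableT_comp.
have mabs : measurable_fun setT (abse \o f) by exact: measurableT_comp.
rewrite -(@ge0_integral_pushforward _ _ _ _ _ _ mphi p setT (abse \o f)) //.
  by rewrite (@eq_measure_integral _ _ _ _ mu) // => A mA _; exact: pmu.
by move=> y _; exact: abse_ge0.
Qed.

Lemma integral_marginal (f : Y -> \bar R) : mu.-integrable setT f ->
  (\int[p]_x f (phi x) = \int[mu]_y f y)%E.
Proof.
move=> intf; have /integrableP[mf _] := intf.
have := @integral_pushforward _ _ _ _ _ _ mphi p setT f mf.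
rewrite preimage_setT => /(_ (integrable_marginal intf) measurableT) <-.
by apply: eq_measure_integral => A mA _; exact: pmu.
Qed.

Lemma ae_marginal (P : Y -> Prop) :
  {ae mu, forall y, P y} -> {ae p, forall x, P (phi x)}.
Proof.
move=> [A [mA muA PA]]; exists (phi @^-1` A); split.
- by rewrite -[X in measurable X]setTI; exact: mphi.
- by rewrite pmu.
- by move=> x /= Px; exact: PA.
Qed.

End Marginal.

Lemma coupling_marginals (R : realType) (d : nat) (mu nu : probability 'rV[R]_d R)
    (p : probability ('rV[R]_d * 'rV[R]_d)%type R) : coupling mu nu p ->
  (measurable_fun setT (fst : 'rV[R]_d * 'rV[R]_d -> 'rV[R]_d) /\
   forall A, measurable A -> p (fst @^-1` A) = mu A) /\
  (measurable_fun setT (snd : 'rV[R]_d * 'rV[R]_d -> 'rV[R]_d) /\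
   forall B, measurable B -> p (snd @^-1` B) = nu B).
Proof.
move=> [pmu pnu]; do 2![split=> //] => A mA.
- by rewrite -pmu //; congr (p _); apply/seteqP; split=> [xy|xy []].
- by rewrite -pnu //; congr (p _); apply/seteqP; split=> [xy|xy []].
Qed.

(** * Almost every point of an optimal plan is a contact point *)

Section Contact.
Variables (R : realType) (d : nat).
Local Notation E := 'rV[R]_d.
Variables (c : E -> E -> R) (mu nu : probability E R)
  (p : probability (E * E)%type R) (f g : E -> \bar R).
Hypotheses (mc : measurable_fun setT (fun xy : E * E => c xy.1 xy.2))
  (c0 : forall x y, 0 <= c x y)
  (popt : optimal_plan c mu nu p) (fgopt : optimal_potentials c mu nu f g).

Lemma plan_cost_optimal : plan_cost c p = transport_cost c mu nu.
Proof.
have [pc pmin] := popt; apply/eqP; rewrite eq_le; apply/andP; split.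
  by apply: le_ereal_inf_tmp => _ [q qc <-]; exact: pmin.
by apply: ereal_inf_lbound; exists p.
Qed.

Lemma contact_ae : {ae p, forall xy, (f xy.1 + g xy.2)%E = (c xy.1 xy.2)%:E}.
Proof.
have [[intf intg flty glty fgc] fgT] := fgopt; have [pcoupling _] := popt.
have [[mfst p1] [msnd p2]] := coupling_marginals pcoupling.
have intfp := integrable_marginal mfst p1 intf.
have intgp := integrable_marginal msnd p2 intg.
have intfg := integrableD measurableT intfp intgp.
have mcE : measurable_fun setT (fun xy : E * E => (c xy.1 xy.2)%:E).
  exact/measurable_EFinP.
(* The cost is finite because it is the sum of the integrals of two integrable potentials; this
   makes [c] integrable for the plan. *)
have fin_T : transport_cost c mu nu \is a fin_num.
  by rewrite -fgT fin_numD !integrable_fin_num.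
have int_c : p.-integrable setT (fun xy : E * E => (c xy.1 xy.2)%:E).
  apply/integrableP; split => //.
  under eq_integral do rewrite gee0_abs ?lee_fin //.
  by rewrite -[X in (X < _)%E]/(plan_cost c p) plan_cost_optimal ltey_eq fin_T.
pose F xy := ((c xy.1 xy.2)%:E - (f xy.1 + g xy.2))%E.
have intF : p.-integrable setT F by exact: integrableB.
(* Where [f + g] is [-oo], the slack is [+oo]. *)
have F0 xy : (0 <= F xy)%E.
  move: (fgc xy.1 xy.2); rewrite /F; case: (f xy.1 + g xy.2)%E => [r| |] //=.
    by rewrite -EFinB !lee_fin subr_ge0.
  by move=> _; exact: leey.
have : (\int[p]_xy `|F xy| = 0)%E.
  rewrite (eq_integral F); last by move=> xy _; rewrite gee0_abs.
  rewrite /F integralB // integralD // (integral_marginal mfst p1) //.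
  rewrite (integral_marginal msnd p2) // fgT.
  by rewrite -[X in (X - _)%E]/(plan_cost c p) plan_cost_optimal subee.
move=> /(ae_eq_integral_abs p measurableT (measurable_int _ intF)).
(* A zero slack forces [f + g] to be finite, so that the subtraction can be undone. *)
apply: filterS => xy /(_ I); rewrite /F /= => Fxy.
have : (f xy.1 + g xy.2 <= (c xy.1 xy.2)%:E)%E by [].
move: Fxy; case: (f xy.1 + g xy.2)%E => [r|//|//].
by rewrite -EFinB => -[/subr0_eq ->].
Qed.
End Contact.

(** * Points in contact for both costs *)

Section CommonContact.
Variables (R : realType) (d : nat).
Local Notation E := 'rV[R]_d.
Variables (mu nu : probability E R) (p : probability (E * E)%type R)
  (f g : E -> \bar R) (h1 h2 : E -> R).
Let c1 := translation_cost h1.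
Let c2 := translation_cost h2.
Hypotheses (h1_ge0 : forall x, 0 <= h1 x) (h2_ge0 : forall x, 0 <= h2 x)
  (h1_cont : continuous h1) (h2_cont : continuous h2)
  (popt1 : optimal_plan c1 mu nu p) (popt2 : optimal_plan c2 mu nu p)
  (fgopt1 : optimal_potentials c1 mu nu f g)
  (fgopt2 : optimal_potentials c2 mu nu f g).

Definition common_contact (x y : E) :=
  (f x + g y)%E = (c1 x y)%:E /\ (f x + g y)%E = (c2 x y)%:E.

Lemma common_contact_ae : {ae p, forall xy,
  [/\ common_contact xy.1 xy.2, supp mu xy.1 & supp nu xy.2]}.
Proof.
have [pcoupling _] := popt1.
have [[mfst p1] [msnd p2]] := coupling_marginals pcoupling.
have C1 := contact_ae (measurable_translation_cost h1_cont)
  (fun x y => h1_ge0 (x - y)) popt1 fgopt1.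
have C2 := contact_ae (measurable_translation_cost h2_cont)
  (fun x y => h2_ge0 (x - y)) popt2 fgopt2.
have S1 := ae_marginal mfst p1 (supp_ae mu).
have S2 := ae_marginal msnd p2 (supp_ae nu).
by apply: filterS (filterI (filterI C1 C2) (filterI S1 S2)) => xy [[? ?] [? ?]].
Qed.

(** The plan has mass 1, so what holds almost everywhere holds somewhere. This point decides the
    constant [k]. *)
Lemma common_contact_supp :
  exists x y, [/\ common_contact x y, supp mu x & supp nu y].
Proof.
have pf : ProperFilter (almost_everywhere p).
  have p_gt0 : (0 < p setT)%E by rewrite probability_setT.
  exact: ae_properfilter_algebraOfSetsType.
by have [xy ?] := @filter_ex _ _ pf _ common_contact_ae; exists xy.1, xy.2.
Qed.

(** Without contact points above an open [A] around [x0], the set [A] times the whole space would be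
    null for the plan, against [mu A > 0]. *)
Lemma common_contact_near (x0 : E) (U : set E) : supp mu x0 -> nbhs x0 U ->
  exists x y, U x /\ common_contact x y.
Proof.
move=> x0mu; rewrite nbhsE => -[A [oA Ax0] AU].
have [[pmu _] _] := popt1.
have mA : measurable A by exact: rV_open_measurable.
apply: contrapT => noxy.
have [N [mN pN sub]] := common_contact_ae.
have := x0mu _ oA Ax0; rewrite -pmu // lt_neqAle => /andP[/negP[]].
rewrite eq_sym eq_le measure_ge0 andbT -pN; apply: le_measure.
- by rewrite inE; exact: measurableX.
- by rewrite inE.
move=> [x y] [/= Ax _]; apply: sub => /= -[con _ _]; apply: noxy.
by exists x, y; split => //; exact: AU.
Qed.
End CommonContact.

(** * Boundedness and limits of contact points *)

Section ContactLimit.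
Variables (R : realType) (d : nat).
Local Notation E := 'rV[R]_d.
Implicit Types (h phi : E -> R) (C : E -> E -> Prop) (D : set E) (x y z : E).

(** Here [phi] stands for the real part of the potential, [D] for the set where it is finite and [C]
    for the contact relation. *)
Definition contact_maximal h phi D C := forall x y z, C x y -> D x -> D z ->
  phi z - h (z - y) <= phi x - h (x - y).

(* Moving x by rho towards y changes h (x - y) by at most
   rho (h 0 - h (x - y)) / |x - y|, which tends to -oo as y goes to infinity,
   while phi changes by at most 2. *)
Lemma contact_bounded h phi D C x0 :
    strictly_convex h -> (forall x, 0 <= h x) -> superlinear h ->
    contact_maximal h phi D C -> nbhs x0 D -> {for x0, continuous phi} ->
  exists M : R, \forall x \near x0, forall y, C x y -> `|y| <= M.
Proof.
move=> hc h0 hsup hC Dx0 phic.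
have /nbhs_ballP[r /= r0 rD] : \forall x \near x0, D x /\ `|phi x0 - phi x| < 1.
  near=> x; split; first by near: x.
  by near: x; move/cvgrPdist_lt : (phic) => /(_ 1 ltr01).
(* Half for the distance from [x0] to [x], half for the step towards [y], so that [z] stays in the
   ball of radius [r]. *)
pose rho := r / 2.
have rho0 : 0 < rho by rewrite divr_gt0.
(* Multiplied by [rho], this bound exceeds the variation 2 of [phi] plus [rho * h 0]. *)
have [M1 M1P] := hsup (2 / rho + h 0 + 1).
(* Beyond [rho] the fraction [t] is below 1; beyond 1 it is at most [rho]. *)
pose M := Num.max M1 (Num.max rho 1).
exists (`|x0| + rho + M); apply/nbhs_ballP; exists rho => //= x x0x y Cxy.
pose q := x - y; pose n := enorm q.
have [nM|] := leP n M.
  have -> : y = x0 - (x0 - x) - q by rewrite /q subKr subKr.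
  rewrite (le_trans (ler_normB _ _)) // lerD //; last first.
    exact: le_trans (norm_le_enorm _) nM.
  rewrite (le_trans (ler_normB _ _)) // lerD2l.
  by move: x0x; rewrite -ball_normE /= => /ltW.
rewrite !gt_max => /and3P[M1n rhon n1].
have n0 : 0 < n by exact: lt_trans n1.
pose t := rho / n.
have t0 : 0 < t by rewrite divr_gt0.
have t1 : t <= 1 by rewrite ler_pdivrMr // mul1r ltW.
pose z := x + t *: (- q).
have [Dx phix] : D x /\ `|phi x0 - phi x| < 1.
  by apply: rD; apply: le_ball x0x; rewrite /rho; lra.
have [Dz phiz] : D z /\ `|phi x0 - phi z| < 1.
  apply: rD; move: x0x; rewrite -!ball_normE /= => x0x.
  have -> : x0 - z = (x0 - x) + t *: q by rewrite /z scalerN opprD opprK addrA.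
  rewrite (le_lt_trans (ler_normD _ _)) // normrZ gtr0_norm //.
  have : t * `|q| <= rho.
    by rewrite /t mulrAC ler_pdivrMr // ler_pM2l // norm_le_enorm.
  by rewrite /rho in x0x *; lra.
have := hC x y z Cxy Dx Dz.
have -> : z - y = q + t *: (- q) by rewrite /z addrAC.
rewrite -/q => le_phi.
have := @convex_scale_le _ _ h q (- q) t hc.
rewrite t0 t1 subrr => /(_ erefl) le_h.
have th0 : t * h 0 <= rho * h 0.
  by rewrite ler_wpM2r // ler_pdivrMr // ler_peMr // ltW.
have thq : 2 + rho * h 0 + rho < t * h q.
  have -> : t * h q = rho * (h q / n) by rewrite /t mulrAC mulrA.
  have -> : 2 + rho * h 0 + rho = rho * (2 / rho + h 0 + 1).
    by rewrite !mulrDr mulr1 mulrCA divff ?gt_eqF // mulr1.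
  by rewrite ltr_pM2l //; exact: M1P.
move: phix phiz; rewrite !ltr_norml => /andP[? ?] /andP[? ?].
exfalso; rewrite mulrBr in le_h; lra.
Unshelve. all: by end_near. Qed.

(** The sets [B U] generate a proper filter containing a compact ball; [y0] is a cluster point of
    it. *)
Lemma contact_limit C x0 (M : R) :
    (forall U, nbhs x0 U -> exists x y, U x /\ C x y) ->
    (\forall x \near x0, forall y, C x y -> `|y| <= M) ->
  exists y0, forall U V, nbhs x0 U -> nbhs y0 V ->
    exists x y, [/\ U x, V y & C x y].
Proof.
move=> Cx0 CM.
pose B U := [set y | exists x, U x /\ C x y].
pose F := filter_from (nbhs x0) B.
have FF : ProperFilter F.
  apply: filter_from_proper => [|U /Cx0[x [y [Ux Cxy]]]]; last by exists y, x.
  apply: filter_from_filter; first by exists setT; exact: filterT.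
  move=> U W Ux0 Wx0; exists (U `&` W); first exact: filterI.
  by move=> y [x [[Ux Wx] Cxy]]; split; exists x.
pose K := [set y : E | `|y| <= M].
have cK : compact K.
  apply: bounded_closed_compact.
    exists M; split=> [|N MN y /= yM]; first exact: num_real.
    exact: le_trans yM (ltW MN).
  apply: (@preimage_closed _ _ (fun y : E => `|y|) [set r | r <= M]).
    by move=> y _; exact: (@norm_continuous _ _ y).
  exact: closed_le.
have FK : F K by exists [set x | forall y, C x y -> `|y| <= M] => // y [x []]; apply.
have [y0 [_ y0F]] := cK F FF FK.
exists y0 => U V Ux0 Vy0.
have FU : F (B U) by exists U.
by have [y [[x [Ux Cxy]] Vy]] := y0F _ _ FU Vy0; exists x, y.
Qed.

(** If some [z] did better than [x0], then by continuity of [G] it would also do better than [x] for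
    a contact pair [(x, y)] close to [(x0, y0)]. *)
Lemma contact_maximal_limit h phi D C x0 y0 :
    contact_maximal h phi D C -> continuous h -> nbhs x0 D ->
    {for x0, continuous phi} ->
    (forall U V, nbhs x0 U -> nbhs y0 V -> exists x y, [/\ U x, V y & C x y]) ->
  \forall z \near x0, phi z - h (z - y0) <= phi x0 - h (x0 - y0).
Proof.
move=> hC hcont Dx0 phic Clim; near=> z; rewrite leNgt; apply/negP => lt_z.
have Dz : D z by near: z.
pose G (xy : E * E) := phi z - h (z - xy.2) - (phi xy.1 - h (xy.1 - xy.2)).
have G0 : 0 < G (x0, y0) by rewrite subr_gt0.
have Gc : {for (x0, y0), continuous G}.
  have c1 : (h (z - xy.2)) @[xy --> (x0, y0)] --> h (z - y0).
    apply: (@continuous_comp _ _ _ (fun xy : E * E => z - xy.2) h (x0, y0)).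
      exact: cvgB (cvg_cst _) cvg_snd.
    exact: hcont.
  have c2 : (h (xy.1 - xy.2)) @[xy --> (x0, y0)] --> h (x0 - y0).
    apply: (@continuous_comp _ _ _ (fun xy : E * E => xy.1 - xy.2) h (x0, y0)).
      exact: cvgB cvg_fst cvg_snd.
    exact: hcont.
  have c3 : (phi xy.1) @[xy --> (x0, y0)] --> phi x0.
    by apply: (@continuous_comp _ _ _ fst phi (x0, y0)); [exact: cvg_fst|].
  exact: cvgB (cvgB (cvg_cst _) c1) (cvgB c3 c2).
have [[U V] [/= Ux0 Vy0] UV] : nbhs (x0, y0) [set xy | 0 < G xy].
  by apply: (Gc [set r | 0 < r]); apply: open_nbhs_nbhs; split=> //; exact: open_gt.
have [x [y [[Ux Dx] Vy Cxy]]] := Clim _ _ (filterI Ux0 Dx0) Vy0.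
have : 0 < G (x, y) by exact: (UV (x, y)).
by rewrite subr_gt0 ltNge (hC x y z).
Unshelve. all: by end_near. Qed.
End ContactLimit.

(** * Gradients of the potential as common gradients of both cost functions *)

Section GradientOfPotential.
Variables (R : realType) (d : nat) (h1 h2 : 'rV[R]_d -> R)
  (mu nu : probability 'rV[R]_d R) (p : probability ('rV[R]_d * 'rV[R]_d)%type R)
  (f g : 'rV[R]_d -> \bar R).
Let c1 := translation_cost h1.
Let c2 := translation_cost h2.
Hypotheses (h1H : classH h1) (h2H : classH h2)
  (popt1 : optimal_plan c1 mu nu p) (popt2 : optimal_plan c2 mu nu p)
  (fgopt1 : optimal_potentials c1 mu nu f g)
  (fgopt2 : optimal_potentials c2 mu nu f g).

Lemma classH_continuous (h : 'rV[R]_d -> R) : classH h -> continuous h.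
Proof. by move=> [_ _ dh _ _] x; exact: differentiable_continuous (dh x). Qed.

(** Equality at [x] and the dual constraint at [z] share the term [g y], which is finite by contact
    and cancels. *)
Lemma common_contact_maximal :
  contact_maximal h1 (fine \o f) [set x | f x \is a fin_num]
    (common_contact f g h1 h2) /\
  contact_maximal h2 (fine \o f) [set x | f x \is a fin_num]
    (common_contact f g h1 h2).
Proof.
have [[_ _ _ _ le1] _] := fgopt1; have [[_ _ _ _ le2] _] := fgopt2.
suff max h x y z : (f x + g y)%E = (h (x - y))%:E ->
    (f z + g y <= (h (z - y))%:E)%E -> f x \is a fin_num -> f z \is a fin_num ->
    fine (f z) - h (z - y) <= fine (f x) - h (x - y).
  by split=> x y z [con1 con2] /= fx fz; [apply: max con1 _ _ _|apply: max con2 _ _ _].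
case: (f x) (f z) (g y) => [a| |] [b| |] [e| |] //.
by rewrite -!EFinD => -[<-]; rewrite lee_fin /=; lra.
Qed.

(** The limit [y0] is extracted once, from pairs in contact for both costs, so the same
    [q = x0 - y0] serves [h1] and [h2]. *)
Lemma potential_gradient_common y : potential_gradients mu f y ->
  exists q, y = grad h1 q /\ y = grad h2 q.
Proof.
move=> [x0 [/interior_subset x0mu [fin_f df]] <-].
have [h1_ge0 h1c dh1 _ h1sup] := h1H; have [h2_ge0 h2c dh2 _ _] := h2H.
have h1cont := classH_continuous h1H; have h2cont := classH_continuous h2H.
have [max1 max2] := common_contact_maximal.
have fcont := differentiable_continuous df.
have [M CM] := contact_bounded h1c h1_ge0 h1sup max1 fin_f fcont.
have Cnear U : nbhs x0 U -> exists x y, U x /\ common_contact f g h1 h2 x y.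
  exact: (common_contact_near h1_ge0 h2_ge0 h1cont h2cont popt1 popt2).
have [y0 y0P] := contact_limit Cnear CM.
exists (x0 - y0); split.
  exact: grad_eq_local_max (contact_maximal_limit max1 h1cont fin_f fcont y0P).
exact: grad_eq_local_max (contact_maximal_limit max2 h2cont fin_f fcont y0P).
Qed.

End GradientOfPotential.

Theorem theorem3p3 (R : realType) (d : nat) (h1 h2 : 'rV[R]_d -> R)
    (h1H : classH h1) (h2H : classH h2)
    (V : Type) (V_nonempty : inhabited V)
    (mu nu : V -> probability 'rV[R]_d R)
    (plan : V -> probability ('rV[R]_d * 'rV[R]_d)%type R)
    (f g : V -> 'rV[R]_d -> \bar R) :
  let c1 := translation_cost h1 in
  let c2 := translation_cost h2 in
  let X := \bigcup_(v in [set: V]) potential_gradients (mu v) (f v) in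
  (forall v, mu v `<< lebesgue_rV R d) ->
  (forall v, optimal_plan c1 (mu v) (nu v) (plan v) /\
             optimal_plan c2 (mu v) (nu v) (plan v)) ->
  (forall v, optimal_potentials c1 (mu v) (nu v) (f v) (g v) /\
             optimal_potentials c2 (mu v) (nu v) (f v) (g v)) ->
  (forall y, X y -> egrad (conjugate h1) y = egrad (conjugate h2) y) /\
  (forall X' : set 'rV[R]_d, open X' -> connected X' -> grad h1 @` X' `<=` X ->
    exists k : R,
      (forall x, X' x -> h1 x = h2 x + k) /\
      ((exists v : V,
          transport_cost c1 (mu v) (nu v) = transport_cost c2 (mu v) (nu v) /\
          [set x - y | x in supp (mu v) & y in supp (nu v)] `<=` X') ->
        k = 0)).
Proof.
move=> c1 c2 X _ popt fgopt.
have [h1_ge0 h1c dh1 _ _] := h1H; have [h2_ge0 h2c dh2 _ _] := h2H.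
have Xgrad y : X y -> exists q, y = grad h1 q /\ y = grad h2 q.
  move=> [v _ yv]; have [popt1 popt2] := popt v; have [fgopt1 fgopt2] := fgopt v.
  exact: (potential_gradient_common h1H h2H popt1 popt2 fgopt1 fgopt2 yv).
split=> [y /Xgrad[q [yq1 yq2]]|X' oX' cX' gradX'].
  by rewrite {1}yq1 yq2 !egrad_conjugate.
have grad_eq x : X' x -> grad h1 x = grad h2 x.
  move=> X'x; have [|q [q1 q2]] := Xgrad (grad h1 x).
    by apply: gradX'; exists x.
  (* Injectivity of [grad h1] identifies [q] with [x]. *)
  by rewrite {2}(grad_inj h1c dh1 q1).
have cst := eq_grad_cst dh1 dh2 oX' cX' grad_eq.
have [[x0 X'x0]|/set0P/negP/negPn/eqP X'0] := pselect (X' !=set0); last first.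
  by exists 0; split=> // x; rewrite X'0.
exists (h1 x0 - h2 x0); split=> [x X'x|[v [_ suppX']]].
  by rewrite -(cst x x0) // addrC subrK.
have [popt1 popt2] := popt v; have [fgopt1 fgopt2] := fgopt v.
have [x [y [[con1 con2] xmu ynu]]] := common_contact_supp h1_ge0 h2_ge0
  (classH_continuous h1H) (classH_continuous h2H) popt1 popt2 fgopt1 fgopt2.
have X'xy : X' (x - y) by apply: suppX'; exists x => //; exists y.
(* The constant is read off at [x - y], where both costs equal [f x + g y]. *)
rewrite (cst x0 (x - y)) //; apply/eqP; rewrite subr_eq0; apply/eqP.
by move: con1; rewrite con2 => -[].
Qed.
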